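(* Let $x_0,a,r\in\mathbb{Z}$ and let $(x_n)_{n\geq 0}$ be the sequence of integers with initial value $x_0$ satisfying $$x_n=ax_{n-1}+arx_{n-2}+\dots+ar^{n-1}x_0=\sum_{i=1}^{n} a r^{i-1}x_{n-i}$$ for all integers $n\geq 1$. Then for every prime $p$, the quotient set $R((x_n)_{n\geq 0})$ is not dense in $\mathbb{Q}_p$.
   Context: For a set of integers $A$, the quotient set (ratio set) of $A$ is $R(A)=\{a/b : a,b\in A,\ b\neq 0\}$; for a sequence $(x_n)_{n\ge 0}$ of integers, its quotient set $R((x_n)_{n\ge0})$ is $R(\{x_n : n\geq 0\})$. $\mathbb{Q}_p$ is the field of $p$-adic numbers, and denseness is with respect to the $p$-adic metric, with $R(A)\subset\mathbb{Q}\subset\mathbb{Q}_p$. The convention $r^0=1$ is used (also for $r=0$). *)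

(* Defs.v *)
From HB Require Import structures.
From mathcomp Require Import all_boot all_order all_algebra.
From mathcomp Require Import generic_quotient ring_quotient.
From mathcomp Require Import boolp classical_sets functions filter.
From mathcomp Require Import topology_structure uniform_structure.
From mathcomp Require Import pseudometric_structure metric_structure topology.
From mathcomp Require Import zify ring lra.

Set Implicit Arguments.
Unset Strict Implicit.
Unset Printing Implicit Defensive.

Import Order.TTheory GRing.Theory Num.Theory.

Local Open Scope classical_set_scope.
Local Open Scope ring_scope.
Local Open Scope quotient_scope.

Definition padic_val (p : nat) (x : rat) : int :=
  (logn p `|numq x|%N)%:Z - (logn p `|denq x|%N)%:Z.

(* logn p is 0 when p is not prime, so padic_abs p is then the trivial absolute
   value; only prime p is of interest. *)
Definition padic_abs (p : nat) (x : rat) : rat :=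
  if x == 0 then 0 else p%:R ^ (- padic_val p x).

Section PadicAbs.
Variable p : nat.
Local Notation pabs := (padic_abs p).
Implicit Types x y : rat.

Lemma padic_valE (m n : int) : m != 0 -> n != 0 ->
  padic_val p (m%:~R / n%:~R) = (logn p `|m|%N)%:Z - (logn p `|n|%N)%:Z.
Proof.
move=> m0 n0; rewrite /padic_val; set x := _ / _ : rat.
have x0 : x != 0 by rewrite mulf_neq0 ?invr_eq0 ?intr_eq0.
have E : (numq x * n)%R = (m * denq x)%R.
  apply/eqP; rewrite -(eqr_int rat) !rmorphM /=; apply/eqP.
  by rewrite numqE mulrAC divfK ?intr_eq0.
have /(congr1 (fun k => logn p `|k|%N)) := E.
rewrite !abszM !lognM ?absz_gt0 ?numq_eq0 ?denq_neq0 //.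
by lia.
Qed.

Lemma padic_valM x y : x != 0 -> y != 0 ->
  padic_val p (x * y) = padic_val p x + padic_val p y.
Proof.
move=> x0 y0.
have -> : x * y = (numq x * numq y)%:~R / (denq x * denq y)%:~R.
  by rewrite !rmorphM /= -mulf_div !divq_num_den.
rewrite padic_valE ?mulf_neq0 ?numq_eq0 ?denq_neq0 //.
rewrite !abszM !lognM ?absz_gt0 ?numq_eq0 ?denq_neq0 // /padic_val !PoszD.
by rewrite opprD addrACA.
Qed.

Lemma logn_nprime n : ~~ prime p -> logn p n = 0%N.
Proof. by move=> /negPf pN; rewrite lognE pN. Qed.

Lemma padic_val_nprime x : ~~ prime p -> padic_val p x = 0.
Proof. by move=> pN; rewrite /padic_val !logn_nprime. Qed.

Lemma padic_abs0 : pabs 0 = 0. Proof. by rewrite /padic_abs eqxx. Qed.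

Lemma padic_abs_gt0 x : x != 0 -> 0 < pabs x.
Proof.
move=> /negPf x0; rewrite /padic_abs x0.
have [/prime_gt0 p0|pN] := boolP (prime p); first by rewrite exprz_gt0 ?ltr0n.
by rewrite padic_val_nprime // oppr0 expr0z.
Qed.

Lemma padic_abs_ge0 x : 0 <= pabs x.
Proof.
have [->|x0] := eqVneq x 0; first by rewrite padic_abs0.
by rewrite ltW // padic_abs_gt0.
Qed.

Lemma padic_abs_eq0 x : (pabs x == 0) = (x == 0).
Proof.
have [->|x0] := eqVneq x 0; first by rewrite padic_abs0 eqxx.
by rewrite gt_eqF // padic_abs_gt0.
Qed.

Lemma padic_absM x y : pabs (x * y) = pabs x * pabs y.
Proof.
have [->|x0] := eqVneq x 0; first by rewrite mul0r padic_abs0 mul0r.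
have [->|y0] := eqVneq y 0; first by rewrite mulr0 padic_abs0 mulr0.
rewrite /padic_abs mulf_eq0 (negPf x0) (negPf y0) /= padic_valM //.
have [/prime_gt0 p0|pN] := boolP (prime p).
  by rewrite opprD expfzDr // pnatr_eq0 -lt0n.
by rewrite !padic_val_nprime // oppr0 expr0z mulr1.
Qed.

Lemma padic_abs1 : pabs 1 = 1.
Proof. by rewrite /padic_abs oner_eq0 /padic_val /= logn1 subrr expr0z. Qed.

Lemma padic_absN x : pabs (- x) = pabs x.
Proof. by rewrite /padic_abs oppr_eq0 /padic_val numqN denqN abszN. Qed.

Lemma padic_absB x y : pabs (x - y) = pabs (y - x).
Proof. by rewrite -padic_absN opprB. Qed.

Lemma padic_absV x : pabs x^-1 = (pabs x)^-1.
Proof.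
have [->|x0] := eqVneq x 0; first by rewrite invr0 padic_abs0.
have px0 : pabs x != 0 by rewrite padic_abs_eq0.
by apply: (mulfI px0); rewrite -padic_absM !mulfV // padic_abs1.
Qed.

Lemma padic_abs_le1 x : (pabs x <= 1) = (x == 0) || (0 <= padic_val p x).
Proof.
rewrite /padic_abs; case: eqP => [_|_] /=; first exact: ler01.
have [pP|pN] := boolP (prime p); last first.
  by rewrite padic_val_nprime // oppr0 expr0z !lexx.
have p1 : 1 < p%:R :> rat by rewrite ltr1n prime_gt1.
by rewrite -[leRHS](expr0z p%:R) ler_eXz2l // oppr_le0.
Qed.

Lemma logn_addz (m n : int) : n != 0 -> m + n != 0 -> m != 0 ->
  (logn p `|n| <= logn p `|m|)%N -> (logn p `|n| <= logn p `|(m + n)%R|)%N.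
Proof.
move=> n0 mn0 m0; have [pP|pN] := boolP (prime p); last first.
  by rewrite !logn_nprime.
rewrite -!pfactor_dvdn ?absz_gt0 // => dm.
have dn : (p ^ logn p `|n| %| `|n|)%N by rewrite pfactor_dvdn ?absz_gt0.
have : ((p ^ logn p `|n|)%N%:Z %| m + n)%Z by rewrite rpredD.
by [].
Qed.

Lemma padic_abs_ultra1 x : pabs x <= 1 -> pabs (x + 1) <= 1.
Proof.
rewrite !padic_abs_le1; have [->|x0] := eqVneq x 0.
  by rewrite add0r /padic_val /= !logn1 subrr.
have [//|/= x1] := eqVneq (x + 1) 0.
have E : x + 1 = (numq x + denq x)%:~R / (denq x)%:~R.
  by rewrite rmorphD mulrDl mulfV ?intr_eq0 ?denq_neq0 // divq_num_den.
have nd0 : numq x + denq x != 0.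
  by apply: contraNneq x1 => h; rewrite E h mul0r.
rewrite E padic_valE ?denq_neq0 // !subr_ge0 !lez_nat.
by apply: logn_addz; rewrite ?denq_neq0 ?numq_eq0.
Qed.

Lemma padic_abs_ultra x y : pabs (x + y) <= Num.max (pabs x) (pabs y).
Proof.
wlog le_xy : x y / pabs x <= pabs y.
  move=> H; case/orP: (le_total (pabs x) (pabs y)) => h; first exact: H.
  by rewrite addrC maxC; exact: H.
rewrite max_r //; have [y0|y0] := eqVneq y 0.
  by move: le_xy; rewrite y0 addr0.
have -> : x + y = (x / y + 1) * y by rewrite mulrDl mul1r divfK.
rewrite padic_absM ger_pMl ?padic_abs_gt0 //; apply: padic_abs_ultra1.
by rewrite padic_absM padic_absV ler_pdivrMr ?mul1r ?padic_abs_gt0.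
Qed.

Lemma padic_absD x y : pabs (x + y) <= pabs x + pabs y.
Proof.
apply: le_trans (padic_abs_ultra x y) _.
by rewrite ge_max lerDl lerDr !padic_abs_ge0.
Qed.

Lemma padic_abs_dist x y : `|pabs x - pabs y| <= pabs (x - y).
Proof.
rewrite ler_norml; apply/andP; split.
  by rewrite lerNl opprB lerBlDr padic_absB -{1}(subrK x y) padic_absD.
by rewrite lerBlDr -{1}(subrK y x) padic_absD.
Qed.

Lemma padic_abs_iso x y : pabs (x - y) < pabs y -> pabs x = pabs y.
Proof.
move=> h; apply/le_anti/andP; split.
  rewrite -{1}(subrK y x); apply: le_trans (padic_abs_ultra _ _) _.
  by rewrite ge_max lexx ltW.
have := padic_abs_ultra (y - x) x; rewrite subrK padic_absB le_max.
by rewrite leNgt h.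
Qed.

End PadicAbs.

Definition padic_cauchy (p : nat) : {pred nat -> rat} := fun u =>
  `[< forall e : rat, 0 < e ->
      \forall m & n \near \oo, padic_abs p (u m - u n) < e >].

Section CauchyRing.
Variable p : nat.
Local Notation pabs := (padic_abs p).
Implicit Types u v : nat -> rat.

Lemma padic_cauchyP u : reflect
  (forall e : rat, 0 < e ->
    exists N, forall m n, (N <= m)%N -> (N <= n)%N -> pabs (u m - u n) < e)
  (u \in padic_cauchy p).
Proof.
apply: (iffP (asboolP _)) => cu e e0.
  have [[A B] /= [[N1 _ h1] [N2 _ h2]] h] := cu e e0.
  exists (maxn N1 N2) => m n; rewrite !geq_max => /andP[m1 m2] /andP[n1 n2].
  by apply: (h (m, n)); split => /=; [apply: h1|apply: h2].
have [N h] := cu e e0.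
exists ([set n | (N <= n)%N], [set n | (N <= n)%N]) => /=.
  by split; exists N.
by case=> m n [/= hm hn]; apply: h.
Qed.

Lemma padic_cauchy_bounded u : u \in padic_cauchy p ->
  exists2 M : rat, 0 < M & forall n, pabs (u n) <= M.
Proof.
move=> /padic_cauchyP/(_ 1 ltr01)[N h].
exists (1 + \sum_(i < N.+1) pabs (u i)) => [|n].
  by rewrite ltr_pwDl // sumr_ge0 // => i _; exact: padic_abs_ge0.
have le_sum (k : 'I_N.+1) : pabs (u k) <= \sum_(i < N.+1) pabs (u i).
  by rewrite (bigD1 k) //= lerDl sumr_ge0 // => i _; exact: padic_abs_ge0.
have [nN|Nn] := ltnP n N.+1.
  by apply: le_trans (le_sum (Ordinal nN)) _; rewrite lerDr.
rewrite -(subrK (u N) (u n)); apply: le_trans (padic_absD _ _ _) _.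
by apply: lerD (le_sum ord_max); apply/ltW/h => //; exact: ltnW.
Qed.

Lemma padic_cauchy_subring : subring_closed (padic_cauchy p).
Proof.
split=> [|u v /padic_cauchyP cu /padic_cauchyP cv|u v cu cv].
- by apply/padic_cauchyP => e e0; exists 0%N => m n _ _; rewrite subrr padic_abs0.
- apply/padic_cauchyP => e e0; have e20 : 0 < e / 2 by lra.
  have [[N1 h1] [N2 h2]] := (cu _ e20, cv _ e20).
  exists (maxn N1 N2) => m n; rewrite !geq_max => /andP[m1 m2] /andP[n1 n2].
  rewrite (_ : _ - _ = (u m - u n) + (v n - v m)); last first.
    by rewrite -[(u - v) m]/(u m - v m) -[(u - v) n]/(u n - v n); ring.
  apply: le_lt_trans (padic_absD _ _ _) _.
  by have := h1 _ _ m1 n1; have := h2 _ _ n2 m2; lra.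
- have [A A0 hA] := padic_cauchy_bounded cu.
  have [B B0 hB] := padic_cauchy_bounded cv.
  apply/padic_cauchyP => e e0.
  have eA : 0 < e / 2 / A by rewrite !divr_gt0.
  have eB : 0 < e / 2 / B by rewrite !divr_gt0.
  have [N1 h1] := padic_cauchyP _ cu _ eB.
  have [N2 h2] := padic_cauchyP _ cv _ eA.
  exists (maxn N1 N2) => m n; rewrite !geq_max => /andP[m1 m2] /andP[n1 n2].
  rewrite (_ : _ - _ = (u m - u n) * v m + u n * (v m - v n)); last first.
    by rewrite -[(u * v) m]/(u m * v m) -[(u * v) n]/(u n * v n); ring.
  apply: le_lt_trans (padic_absD _ _ _) _; rewrite !padic_absM.
  have := h1 _ _ m1 n1; rewrite ltr_pdivlMr // => k1.
  have := h2 _ _ m2 n2; rewrite ltr_pdivlMr // => k2.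
  have : pabs (u m - u n) * pabs (v m) <= pabs (u m - u n) * B.
    by rewrite ler_wpM2l ?padic_abs_ge0.
  have : pabs (u n) * pabs (v m - v n) <= A * pabs (v m - v n).
    by rewrite ler_wpM2r ?padic_abs_ge0.
  by lra.
Qed.

HB.instance Definition _ :=
  GRing.isSubringClosed.Build (nat -> rat) (padic_cauchy p) padic_cauchy_subring.

End CauchyRing.

Record cauchy_seq (p : nat) := CauchySeq {
  cauchy_fun :> nat -> rat;
  _ : cauchy_fun \in padic_cauchy p
}.

HB.instance Definition _ p := [isSub for @cauchy_fun p].
HB.instance Definition _ p := [Choice of cauchy_seq p by <:].
HB.instance Definition _ p :=
  [SubChoice_isSubComNzRing of cauchy_seq p by <:].

Definition padic_null (p : nat) : {pred cauchy_seq p} := fun u =>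
  `[< forall e : rat, 0 < e -> \forall n \near \oo, padic_abs p (u n) < e >].
Arguments padic_null : clear implicits.

Section NullIdeal.
Variable p : nat.
Local Notation pabs := (padic_abs p).
Implicit Types u v : cauchy_seq p.

Lemma cauchy_seqP u (e : rat) : 0 < e ->
  exists N, forall m n, (N <= m)%N -> (N <= n)%N -> pabs (u m - u n) < e.
Proof. by apply: padic_cauchyP; case: u. Qed.

Lemma padic_nullP u : reflect
  (forall e : rat, 0 < e ->
    exists N, forall n, (N <= n)%N -> pabs (u n) < e)
  (u \in padic_null p).
Proof.
apply: (iffP (asboolP _)) => nu e e0; have [N] := nu e e0.
  by move=> _ h; exists N => n; apply: h.
by move=> h; exists N.
Qed.

Lemma cauchy_seqB u v n : (u - v) n = u n - v n.
Proof. by []. Qed.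

Lemma cauchy_seqN u n : (- u) n = - u n.
Proof. by []. Qed.

Lemma cauchy_seqD u v n : (u + v) n = u n + v n.
Proof. by []. Qed.

Lemma cauchy_seqM u v n : (u * v) n = u n * v n.
Proof. by []. Qed.

Lemma cauchy_seq1 n : (1 : cauchy_seq p) n = 1.
Proof. by []. Qed.

Lemma cauchy_seq0 n : (0 : cauchy_seq p) n = 0.
Proof. by []. Qed.

Lemma padic_null_idealr : idealr_closed (padic_null p).
Proof.
split=> [||a u v /padic_nullP nu /padic_nullP nv].
- by apply/padic_nullP => e e0; exists 0%N => n _; rewrite cauchy_seq0 padic_abs0.
- apply/padic_nullP => /(_ 1 ltr01)[N /(_ N (leqnn N))].
  by rewrite cauchy_seq1 padic_abs1 ltxx.
- have [A A0 hA] := padic_cauchy_bounded (valP a).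
  apply/padic_nullP => e e0.
  have eA : 0 < e / 2 / A by rewrite !divr_gt0.
  have e2 : 0 < e / 2 by rewrite divr_gt0.
  have [N1 h1] := nu _ eA; have [N2 h2] := nv _ e2.
  exists (maxn N1 N2) => n; rewrite geq_max => /andP[n1 n2].
  rewrite cauchy_seqD cauchy_seqM.
  apply: le_lt_trans (padic_absD _ _ _) _; rewrite padic_absM.
  have := h1 _ n1; rewrite ltr_pdivlMr // => k1.
  have : pabs (a n) * pabs (u n) <= A * pabs (u n).
    by apply: ler_wpM2r (hA n); exact: padic_abs_ge0.
  by have := h2 _ n2; lra.
Qed.

HB.instance Definition _ :=
  isIdealr.Build (cauchy_seq p) (padic_null p) padic_null_idealr.

Lemma padic_nonnull u : u \notin padic_null p ->
  exists N, forall m n, (N <= m)%N -> (N <= n)%N ->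
    u m != 0 /\ pabs (u m) = pabs (u n).
Proof.
move=> /padic_nullP/existsNP[e /not_implyP[e0 /forallNP ne]].
have [N hN] := cauchy_seqP u e0.
have /existsNP[n0 /not_implyP[Nn0 /negP]] := ne N; rewrite -leNgt => le_e.
have E m : (N <= m)%N -> pabs (u m) = pabs (u n0).
  by move=> Nm; apply: padic_abs_iso; apply: lt_le_trans le_e; apply: hN.
exists N => m n Nm Nn; split; last by rewrite !E.
by rewrite -(padic_abs_eq0 p) E // gt_eqF // (lt_le_trans e0).
Qed.

Lemma cauchy_inv_subproof u : u \notin padic_null p ->
  (fun n => (u n)^-1) \in padic_cauchy p.
Proof.
move=> /padic_nonnull[N hN]; apply/padic_cauchyP => e e0.
have [uN0 _] := hN N N (leqnn N) (leqnn N).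
have c0 : 0 < pabs (u N) by rewrite padic_abs_gt0.
have [N' hN'] := cauchy_seqP u (mulr_gt0 e0 (mulr_gt0 c0 c0)).
exists (maxn N N') => m n; rewrite !geq_max => /andP[m1 m2] /andP[n1 n2].
have [um0 Em] := hN m N m1 (leqnn N); have [un0 En] := hN n N n1 (leqnn N).
rewrite (_ : _ - _ = (u n - u m) / (u m * u n)); last first.
  by field; rewrite um0 un0.
rewrite padic_absM padic_absV padic_absM Em En ltr_pdivrMr ?mulr_gt0 //.
exact: hN'.
Qed.

End NullIdeal.

(* The completion of rat for padic_abs p: Cauchy sequences modulo null sequences. *)
Definition Qp (p : nat) := {ideal_quot (padic_null p)}.

HB.instance Definition _ p := GRing.ComNzRing.on (Qp p).
HB.instance Definition _ p := EqQuotient.on (Qp p).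
HB.instance Definition _ p := NzRingQuotient.on (Qp p).

Definition Qp_of (p : nat) (u : cauchy_seq p) : Qp p := \pi_(Qp p) u.

Fact Qp_of_zmod_morphism p : zmod_morphism (@Qp_of p).
Proof. exact: pi_is_zmod_morphism. Qed.

Fact Qp_of_monoid_morphism p : monoid_morphism (@Qp_of p).
Proof. exact: pi_is_monoid_morphism. Qed.

HB.instance Definition _ p := GRing.isZmodMorphism.Build
  (cauchy_seq p) (Qp p) (@Qp_of p) (@Qp_of_zmod_morphism p).
HB.instance Definition _ p := GRing.isMonoidMorphism.Build
  (cauchy_seq p) (Qp p) (@Qp_of p) (@Qp_of_monoid_morphism p).

Lemma Qp_reprK p (z : Qp p) : Qp_of (repr z) = z.
Proof. exact: reprK. Qed.

Section QpField.
Variable p : nat.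
Local Notation pabs := (padic_abs p).
Implicit Types z : Qp p.

Definition Qp_inv z : Qp p :=
  if z == 0 then 0
  else Qp_of (insubd (0 : cauchy_seq p) (fun n => (repr z n)^-1)).

Lemma Qp_of_eq0 (u : cauchy_seq p) :
  (Qp_of u == 0) = (u \in padic_null p).
Proof.
by rewrite -(rmorph0 (@Qp_of p)) /Qp_of -Quotient.idealrBE subr0.
Qed.

Fact Qp_mulVf z : z != 0 -> Qp_inv z * z = 1.
Proof.
move=> z0; rewrite /Qp_inv (negPf z0); set u := insubd _ _.
have zN : repr z \notin padic_null p by rewrite -Qp_of_eq0 Qp_reprK.
have uE n : u n = (repr z n)^-1.
  by rewrite -[u n]/(val u n) /u insubdK // cauchy_inv_subproof.
rewrite -[X in _ * X](Qp_reprK z) -rmorphM /=; apply/eqP.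
rewrite -(rmorph1 (@Qp_of p)) -subr_eq0 -rmorphB Qp_of_eq0; have [N hN] := padic_nonnull zN.
apply/padic_nullP => e e0; exists N => n Nn.
have [zn0 _] := hN n n Nn Nn.
by rewrite cauchy_seqB cauchy_seqM uE cauchy_seq1 mulVf // subrr padic_abs0.
Qed.

Fact Qp_invr0 : Qp_inv 0 = 0. Proof. by rewrite /Qp_inv eqxx. Qed.

HB.instance Definition _ :=
  GRing.ComNzRing_isField.Build (Qp p) Qp_mulVf Qp_invr0.

End QpField.

(* The p-adic absolute value of a Cauchy sequence has a limit in rat, since it
   is either eventually constant or tends to 0. *)
Definition Qp_norm (p : nat) (z : Qp p) : rat :=
  xget 0 [set c : rat | forall e : rat, 0 < e ->
    \forall n \near \oo, `|padic_abs p (repr z n) - c| < e].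

Section QpMetric.
Variable p : nat.
Local Notation pabs := (padic_abs p).
Implicit Types z w : Qp p.

Lemma Qp_normP (u : cauchy_seq p) (e : rat) : 0 < e ->
  exists N, forall n, (N <= n)%N -> `|pabs (u n) - Qp_norm (Qp_of u)| < e.
Proof.
set z := Qp_of u; rewrite /Qp_norm; set P := [set c | _].
have [c Pc] : exists c, P c.
  have [zn|/padic_nonnull[N hN]] := boolP (repr z \in padic_null p).
    exists 0 => d /(padic_nullP _ zn)[N hN]; exists N => // n /= /hN.
    by rewrite subr0 ger0_norm // padic_abs_ge0.
  exists (pabs (repr z N)) => d d0; exists N => // n /= Nn.
  by have [_ ->] := hN n N Nn (leqnn N); rewrite subrr normr0.
move=> e0; have e20 : 0 < e / 2 by rewrite divr_gt0.
have [N1 _ h1] := xgetPex 0 (ex_intro _ c Pc) _ e20.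
have : u - repr z \in padic_null p.
  by rewrite -Qp_of_eq0 rmorphB /= Qp_reprK subrr.
move=> /padic_nullP/(_ _ e20)[N2 h2].
exists (maxn N1 N2) => n; rewrite geq_max => /andP[n1 n2].
have := h1 n n1; have := h2 n n2; rewrite cauchy_seqB /=.
have := padic_abs_dist p (u n) (repr z n).
rewrite !ltr_norml ler_norml; set t := xget _ _.
by move=> /andP[a b] c' /andP[d f]; apply/andP; split; lra.
Qed.

Lemma Qp_norm0 : Qp_norm (0 : Qp p) = 0.
Proof.
rewrite -(rmorph0 (@Qp_of p)); apply/eqP; rewrite -normr_le0.
apply/ler_addgt0Pl => e e0; rewrite addr0.
have [N /(_ N (leqnn N))] := Qp_normP 0 e0.
by rewrite cauchy_seq0 padic_abs0 sub0r normrN => /ltW.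
Qed.

Lemma Qp_norm_eq0 z : Qp_norm z = 0 -> z = 0.
Proof.
move=> z0; apply/eqP; rewrite -[z]Qp_reprK Qp_of_eq0; apply/padic_nullP => e e0.
have [N h] := Qp_normP (repr z) e0; exists N => n /h.
by rewrite Qp_reprK z0 subr0 ger0_norm // padic_abs_ge0.
Qed.

Lemma Qp_normN z : Qp_norm (- z) = Qp_norm z.
Proof.
rewrite -[z]Qp_reprK -rmorphN /=; apply/eqP; rewrite -subr_eq0 -normr_le0.
apply/ler_addgt0Pl => e e0; rewrite addr0.
have e20 : 0 < e / 2 by rewrite divr_gt0.
have [N1 h1] := Qp_normP (repr z) e20.
have [N2 h2] := Qp_normP (- repr z) e20.
have := h1 _ (leq_maxl N1 N2); have := h2 _ (leq_maxr N1 N2).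
rewrite cauchy_seqN padic_absN !ltr_norml ler_norml.
by move=> /andP[a b] /andP[c d]; apply/andP; split; lra.
Qed.

Lemma Qp_normD z w : Qp_norm (z + w) <= Qp_norm z + Qp_norm w.
Proof.
rewrite -[z]Qp_reprK -[w]Qp_reprK -rmorphD /=; apply/ler_addgt0Pl => e e0.
have e30 : 0 < e / 3 by rewrite divr_gt0.
have [N1 h1] := Qp_normP (repr z) e30.
have [N2 h2] := Qp_normP (repr w) e30.
have [N3 h3] := Qp_normP (repr z + repr w) e30.
pose n := maxn (maxn N1 N2) N3.
have := h1 n; have := h2 n; have := h3 n; rewrite /n !leq_max !leqnn ?orbT.
move=> /(_ isT) + /(_ isT) + /(_ isT); rewrite -/n cauchy_seqD.
have := padic_absD p (repr z n) (repr w n).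
rewrite !ltr_norml {h1 h2 h3}.
move: (pabs _) (pabs _) (pabs _) (Qp_norm _) (Qp_norm _) (Qp_norm _).
by move=> a b c d f g h /andP[? ?] /andP[? ?] /andP[? ?]; lra.
Qed.

Lemma Qp_norm_eventually (u : cauchy_seq p) : u \notin padic_null p ->
  exists N, forall n, (N <= n)%N -> pabs (u n) = Qp_norm (Qp_of u).
Proof.
move=> /padic_nonnull[N hN]; exists N => n Nn.
apply/eqP; rewrite -subr_eq0 -normr_le0; apply/ler_addgt0Pl => e e0.
have [N' h] := Qp_normP u e0; have := h _ (leq_maxr N N').
have [_ <-] := hN n (maxn N N') Nn (leq_maxl _ _).
by rewrite addr0 => /ltW.
Qed.

Lemma Qp_normM z w : Qp_norm (z * w) = Qp_norm z * Qp_norm w.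
Proof.
have [->|z0] := eqVneq z 0; first by rewrite mul0r Qp_norm0 mul0r.
have [->|w0] := eqVneq w 0; first by rewrite mulr0 Qp_norm0 mulr0.
have nn (t : Qp p) : t != 0 -> repr t \notin padic_null p.
  by rewrite -Qp_of_eq0 Qp_reprK.
have zwN : repr z * repr w \notin padic_null p.
  by rewrite -Qp_of_eq0 rmorphM /= !Qp_reprK mulf_neq0.
have [N1 h1] := Qp_norm_eventually (nn _ z0).
have [N2 h2] := Qp_norm_eventually (nn _ w0).
have [N3 h3] := Qp_norm_eventually zwN.
pose n := maxn (maxn N1 N2) N3.
have := h1 n; have := h2 n; have := h3 n; rewrite /n !leq_max !leqnn ?orbT.
move=> /(_ isT) + /(_ isT) + /(_ isT); rewrite -/n cauchy_seqM padic_absM.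
by rewrite rmorphM /= !Qp_reprK => <- <- <-.
Qed.

Lemma Qp_norm1 : Qp_norm (1 : Qp p) = 1.
Proof.
have N1 : (1 : cauchy_seq p) \notin padic_null p by rewrite idealr1.
have [N /(_ N (leqnn N))] := Qp_norm_eventually N1.
by rewrite rmorph1 cauchy_seq1 padic_abs1 => <-.
Qed.

Lemma Qp_norm_int (m : int) : Qp_norm (m%:~R : Qp p) = pabs m%:~R.
Proof.
have cst_nat k n : (k%:R : cauchy_seq p) n = k%:R.
  by elim: k => [|k IH] //; rewrite !mulrSr cauchy_seqD IH.
have cst_int n : (m%:~R : cauchy_seq p) n = m%:~R.
  case: m => k; first by rewrite -!pmulrn cst_nat.
  by rewrite NegzE !mulrNz cauchy_seqN -!pmulrn cst_nat.
have E : Qp_of (m%:~R : cauchy_seq p) = m%:~R by rewrite rmorph_int.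
rewrite -E; apply/esym/eqP; rewrite -subr_eq0 -normr_le0.
apply/ler_addgt0Pl => e e0; rewrite addr0.
have [N /(_ N (leqnn N))] := Qp_normP (m%:~R) e0.
by rewrite cst_int => /ltW.
Qed.

Lemma Qp_norm_ratr (x : rat) : Qp_norm (ratr x : Qp p) = pabs x.
Proof.
have d0 : (denq x)%:~R != 0 :> Qp p.
  apply/eqP => /(congr1 (@Qp_norm p)); rewrite Qp_norm0 Qp_norm_int => /eqP.
  by rewrite padic_abs_eq0 intr_eq0 (negPf (denq_neq0 x)).
have nd0 : Qp_norm ((denq x)%:~R : Qp p) != 0.
  by apply: contraNneq d0 => /Qp_norm_eq0 ->.
apply: (mulIf nd0); rewrite -Qp_normM /ratr divfK // !Qp_norm_int -padic_absM.
by rewrite -numqE.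
Qed.

Definition Qp_dist z w : rat := Qp_norm (z - w).

Fact Qp_distxx z : Qp_dist z z = 0.
Proof. by rewrite /Qp_dist subrr Qp_norm0. Qed.

Fact Qp_dist_positivity z w : Qp_dist z w = 0 -> z = w.
Proof. by move=> /Qp_norm_eq0/eqP; rewrite subr_eq0 => /eqP. Qed.

Fact Qp_dist_sym z w : Qp_dist z w = Qp_dist w z.
Proof. by rewrite /Qp_dist -Qp_normN opprB. Qed.

Fact Qp_dist_triangle w z t : Qp_dist z t <= Qp_dist z w + Qp_dist w t.
Proof. by rewrite /Qp_dist -(subrKA w z) Qp_normD. Qed.

HB.instance Definition _ := @isMetric.Build rat (Qp p)
  Qp_dist Qp_distxx Qp_dist_positivity Qp_dist_sym Qp_dist_triangle.

End QpMetric.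

Definition quotient_set (A : set int) : set rat :=
  [set q | exists a b : int, [/\ A a, A b, b != 0 & q = a%:~R / b%:~R]].

(* Main.v *)
Require Import Defs.
From mathcomp Require Import all_boot all_order all_algebra.
From mathcomp Require Import boolp classical_sets topology.
From mathcomp Require Import ring.

Set Implicit Arguments.
Unset Strict Implicit.
Unset Printing Implicit Defensive.

Import Order.TTheory GRing.Theory Num.Theory.

Local Open Scope classical_set_scope.
Local Open Scope ring_scope.

(* Summing the recurrence shows x_(n+1) = a c^n x_0 with c = a + r.  If c is a
   p-adic unit, the ratios take only the absolute values 0, 1, |a|, 1/|a|, so
   some circle of Q_p contains none of them.  Otherwise |c| < 1, and at most one
   of the numbers a c^n has absolute value 1, so the unit circle contains at
   most three ratios.  A set with finitely many points on some circle
   |z| = |z0|, z0 a nonzero rational, is not dense because circles are open and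
   infinite. *)

Lemma padic_abs_int_le1 (p : nat) (m : int) : padic_abs p m%:~R <= 1.
Proof. by rewrite padic_abs_le1 /padic_val denq_int logn1 subr0 orbT. Qed.

Lemma padic_abs_lt1 (p : nat) (m : int) : prime p ->
  (padic_abs p m%:~R < 1) = (p %| `|m|)%N.
Proof.
move=> pP; have p1 : 1 < p%:R :> rat by rewrite ltr1n prime_gt1.
rewrite /padic_abs intr_eq0; have [->|m0] := eqVneq m 0.
  by rewrite ltr01 dvdn0.
rewrite /padic_val denq_int numq_int logn1 subr0 -[ltRHS](expr0z p%:R).
by rewrite ltr_eXz2l // oppr_lt0 ltz_nat logn_gt0 mem_primes pP absz_gt0 m0.
Qed.

Lemma padic_absX (p n : nat) (x : rat) :
  padic_abs p (x ^+ n) = padic_abs p x ^+ n.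
Proof.
by elim: n => [|n IH]; rewrite ?expr0 ?padic_abs1 // !exprS padic_absM IH.
Qed.

(** Compatibility of [ratr] with subtraction becomes an integer identity once denominators are
    cleared. They are nonzero in [Qp p] because their norm is nonzero. *)
Lemma Qp_dist_ratr (p : nat) (x y : rat) :
  Qp_dist (ratr x : Qp p) (ratr y) = padic_abs p (x - y).
Proof.
have nz (d : int) : d != 0 -> d%:~R != 0 :> Qp p.
  apply: contraNneq => d0; have := Qp_norm_int p d.
  by rewrite d0 Qp_norm0 => /esym/eqP; rewrite padic_abs_eq0 intr_eq0.
rewrite /Qp_dist -(Qp_norm_ratr p (x - y)); congr Qp_norm.
have E : numq (x - y) * (denq x * denq y) =
    (numq x * denq y - numq y * denq x) * denq (x - y).
  apply/eqP; rewrite -(eqr_int rat) !(rmorphM, rmorphB) /= !numqE; apply/eqP.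
  by ring.
have /(congr1 (fun m : int => m%:~R : Qp p)) := E.
rewrite !(rmorphM, rmorphB) /= /ratr => {}E.
rewrite -[LHS](mulfK (nz _ (denq_neq0 (x - y)))); congr (_ / _).
apply: (mulIf (mulf_neq0 (nz _ (denq_neq0 x)) (nz _ (denq_neq0 y)))).
rewrite E mulrAC mulrBl; congr ((_ - _) * _).
  by rewrite mulrA divfK ?nz ?denq_neq0.
by rewrite mulrCA mulrC divfK ?nz ?denq_neq0.
Qed.

(** The circle through [z0] contains the infinitely many points [z0 * (1 + p * k)], since
    [1 + p * k] is a unit. One of them avoids [s], and by the ultrametric inequality a small ball
    around it stays on the circle, hence misses [S]. *)
Lemma not_dense_finite_circle (p : nat) (S : set rat) (z0 : rat) (s : seq rat) :
  prime p -> z0 != 0 ->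
  (forall q, S q -> padic_abs p q = padic_abs p z0 -> q \in s) ->
  ~ dense ((ratr : rat -> Qp p) @` S).
Proof.
move=> pP z00 Ss.
pose f (k : nat) : rat := z0 * (1 + p%:R * k%:R).
have f_inj : injective f.
  move=> k l /(mulfI z00)/addrI/mulfI; rewrite pnatr_eq0 -lt0n prime_gt0 //.
  by move=> /(_ isT)/eqP; rewrite eqr_nat => /eqP.
have f_abs k : padic_abs p (f k) = padic_abs p z0.
  rewrite padic_absM -[RHS]mulr1; congr (_ * _).
  rewrite -[RHS](padic_abs1 p); apply: padic_abs_iso.
  rewrite addrC addKr padic_abs1 -natrM pmulrn padic_abs_lt1 //.
  by rewrite /= dvdn_mulr.
have [k ks] : exists k, f k \notin s.
  apply: contrapT => fs.
  have := @uniq_leq_size _ (map f (iota 0 (size s).+1)) s.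
  rewrite map_inj_uniq // iota_uniq size_map size_iota ltnn => sub.
  suff: false by []; apply: sub => // _ /mapP[k _ ->].
  by apply: contrapT => /negP ?; apply: fs; exists k.
(* The bound by the radius of the circle keeps the ball on the circle; the other bounds keep it away
   from [s]. *)
have [e [e0 ez es]] : exists e : rat, [/\ 0 < e, e <= padic_abs p z0 &
    forall q, q \in s -> e <= padic_abs p (f k - q)].
  elim: s ks {Ss} => [|q s IH].
    by exists (padic_abs p z0); rewrite padic_abs_gt0.
  rewrite inE negb_or => /andP[kq /IH[e [e0 ez es]]].
  exists (Num.min e (padic_abs p (f k - q))); split.
  - by rewrite lt_min e0 padic_abs_gt0 // subr_eq0.
  - by rewrite ge_min ez.
  - move=> t; rewrite inE => /orP[/eqP->|/es et].
      by rewrite ge_min lexx orbT.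
    by rewrite ge_min et.
move=> /(_ (interior (ball (ratr (f k) : Qp p) e))).
case.
- by exists (ratr (f k)); apply: nbhsx_ballx.
- exact: open_interior.
move=> w [/interior_subset wB [q Sq qw]]; move: wB; rewrite -{w}qw.
rewrite ballEmdist /= => h.
have {}h : padic_abs p (f k - q) < e by rewrite -Qp_dist_ratr.
suff /es : q \in s by rewrite leNgt h.
apply: Ss => //; rewrite -(f_abs k); apply: padic_abs_iso.
by rewrite padic_absB f_abs; apply: lt_le_trans ez.
Qed.

(** For [t = 0] all positive powers coincide; [t ^+ k != 0] then leaves only [k = 0], as
    [0 ^+ 0 = 1]. *)
Lemma expr_eq_lt1 (R : numDomainType) (t : R) (k l : nat) :
  0 <= t -> t < 1 -> t ^+ k != 0 -> t ^+ k = t ^+ l -> k = l.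
Proof.
move=> t0 t1; have [->|tn0] := eqVneq t 0.
  by rewrite !expr0n; case: k l => [|k] [|l] //=;
    rewrite ?eqxx // => _ /eqP; rewrite oner_eq0.
move=> _; apply: ieexprIn; first by rewrite lt0r tn0.
by rewrite lt_eqF.
Qed.

Lemma rec_closed_form (a r : int) (x : nat -> int) :
  (forall n : nat, (1 <= n)%N ->
    x n = \sum_(1 <= i < n.+1) a * r ^+ (i - 1)%N * x (n - i)%N) ->
  forall n, x n.+1 = a * (a + r) ^+ n * x 0%N.
Proof.
move=> x_rec; elim=> [|n IH]; first by rewrite x_rec // big_nat1 subnn expr0.
have E m : x m.+1 = \sum_(0 <= i < m.+1) a * r ^+ i * x (m - i)%N.
  rewrite x_rec // big_add1 /=; apply: eq_bigr => i _.
  by rewrite subn1 subSS.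
rewrite E big_nat_recl // expr0 mulr1 subn0.
(* After the first term is split off, the tail is [r] times the previous instance of the recurrence,
   so each step multiplies by [a + r]. *)
have -> : \sum_(0 <= i < n.+1) a * r ^+ i.+1 * x (n.+1 - i.+1)%N = r * x n.+1.
  rewrite E big_distrr /=; apply: eq_bigr => i _.
  by rewrite subSS exprS; ring.
by rewrite IH exprS; ring.
Qed.

(** The cases record which indices vanish in a nonzero ratio of two terms: both, the denominator's,
    the numerator's, or neither. *)
Variant ratio_spec (A C : rat) : rat -> Prop :=
| Ratio1 : ratio_spec A C 1
| RatioL n : ratio_spec A C (A * C ^+ n)
| RatioR n : ratio_spec A C (A * C ^+ n)^-1
| RatioLR k l : ratio_spec A C (C ^+ k / C ^+ l).

(** As [q] is nonzero, so are its numerator and denominator, which allows cancelling the common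
    factors [x 0] and, when both indices are positive, [a]. *)
Lemma quotient_setP (a c : int) (x : nat -> int) (q : rat) :
  (forall n, x n.+1 = a * c ^+ n * x 0%N) ->
  quotient_set (range x) q -> q != 0 -> ratio_spec a%:~R c%:~R q.
Proof.
move=> xE [_ [_ [[m _ <-] [n _ <-] _ ->]]].
case: m n => [|m] [|n]; rewrite ?xE ?rmorphM ?rmorphXn /=;
  set A : rat := a%:~R; set C : rat := c%:~R; set X : rat := (x 0%N)%:~R;
  rewrite mulf_eq0 invr_eq0 ?mulf_eq0 !negb_or.
- by case/andP=> X0 _; rewrite divff //; constructor.
- case/and3P=> X0 _ _.
  have -> : X / (A * C ^+ n * X) = (A * C ^+ n)^-1.
    by rewrite [_ * X]mulrC invfM mulrA divff // mul1r.
  by constructor.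
- by case/andP=> /andP[_ X0] _; rewrite mulfK //; constructor.
- case/andP=> /andP[/andP[A0 _] X0] _.
  by rewrite -mulf_div divff // mulr1 -mulf_div divff // mul1r; constructor.
Qed.

Theorem theorem1p6 (x0 a r : int) (x : nat -> int)
    (x_init : x 0%N = x0)
    (x_rec : forall n : nat, (1 <= n)%N ->
       x n = \sum_(1 <= i < n.+1) a * r ^+ (i - 1)%N * x (n - i)%N)
    (p : nat) (p_prime : prime p) :
  ~ dense ((ratr : rat -> Qp p) @` quotient_set (range x)).
Proof.
pose c := a + r.
have ratioP := quotient_setP (rec_closed_form x_rec).
rewrite -/c in ratioP.
set A : rat := a%:~R in ratioP; set C : rat := c%:~R in ratioP.
have neq0 (q z : rat) : z != 0 -> padic_abs p q = padic_abs p z -> q != 0.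
  by move=> z0 qz; rewrite -(padic_abs_eq0 p) qz padic_abs_eq0.
have A_le1 : padic_abs p A <= 1 by exact: padic_abs_int_le1.
have C_ge0 := padic_abs_ge0 p C.
have [C_lt1|] := boolP (padic_abs p C < 1); last first.
  rewrite lt_neqAle padic_abs_int_le1 andbT negbK => /eqP C1.
  have CX n : padic_abs p (C ^+ n) = 1 by rewrite padic_absX C1 expr1n.
  pose P : rat := p%:R.
  have P0 : P != 0 by rewrite pnatr_eq0 -lt0n prime_gt0.
  have P_gt0 := padic_abs_gt0 p P0.
  have P_lt1 : padic_abs p P < 1 by rewrite /P pmulrn padic_abs_lt1 /= ?dvdnn.
  (* If [A = 0], the ratios have absolute value 0 or 1 only, and the circle through [p] avoids
     both. *)
  have [A0|A0] := eqVneq (padic_abs p A) 0.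
    apply: (@not_dense_finite_circle p _ P [::]) => // q Sq qP; exfalso.
    case: (ratioP _ Sq (neq0 _ _ P0 qP)) (qP) => [|n|n|k l];
      rewrite ?padic_absV ?padic_absM ?padic_absV ?CX ?padic_abs1 ?A0 => E;
      rewrite -E ?mul0r ?invr0 ?invr1 ?mulr1 ?ltxx // in P_gt0 P_lt1.
  have A_gt0 : 0 < padic_abs p A by rewrite lt0r A0 padic_abs_ge0.
  (* The circle through [p * A] works because [|p * A| < |A| <= 1 <= 1 / |A|]. *)
  have PA0 : P * A != 0 by rewrite mulf_neq0 // -(padic_abs_eq0 p).
  apply: (@not_dense_finite_circle p _ (P * A) [::]) => // q Sq qP; exfalso.
  have PA_lt : padic_abs p P * padic_abs p A < padic_abs p A.
    by rewrite gtr_pMl.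
  case: (ratioP _ Sq (neq0 _ _ PA0 qP)) (qP) => [|n|n|k l];
    rewrite ?padic_absV ?padic_absM ?padic_absV ?CX ?padic_abs1 ?invr1 ?mulr1 => E;
    rewrite -E ltNge in PA_lt; move/negP: PA_lt; apply => //.
  by rewrite (le_trans A_le1) // invf_ge1.
(* The absolute values [|A| * |C| ^ n] of these numbers are distinct as long as they are nonzero, so
   1 occurs for at most one [n]; if it never occurs, the choice of [y] is immaterial. *)
have [y yP] : exists y, forall n, padic_abs p (A * C ^+ n) = 1 -> A * C ^+ n = y.
  have [[n0 n01]|none] := pselect (exists n, padic_abs p (A * C ^+ n) = 1).
    exists (A * C ^+ n0) => n; rewrite -n01 !padic_absM !padic_absX => E.
    have : padic_abs p A * padic_abs p C ^+ n != 0.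
      by rewrite E -padic_absX -padic_absM n01 oner_eq0.
    rewrite mulf_eq0 negb_or => /andP[A0 C0].
    by rewrite (expr_eq_lt1 C_ge0 C_lt1 C0 (mulfI A0 E)).
  by exists 0 => n n1; case: none; exists n.
apply: (@not_dense_finite_circle p _ 1 [:: 1; y; y^-1]) => // q Sq q1.
case: (ratioP _ Sq (neq0 _ _ (oner_neq0 _) q1)) (q1) => [|n|n|k l].
- by rewrite inE eqxx.
- by rewrite padic_abs1 => /yP ->; rewrite !inE eqxx orbT.
- rewrite padic_absV padic_abs1 => /(congr1 GRing.inv); rewrite invrK invr1.
  by move=> /yP ->; rewrite !inE eqxx !orbT.
(* A zero denominator gives the quotient 0, off the unit circle. Otherwise absolute value 1 forces
   [k = l], so the quotient is 1. *)
- have [->|Cl0] := eqVneq (C ^+ l) 0.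
    by rewrite invr0 mulr0 padic_abs0 padic_abs1 => /eqP; rewrite eq_sym oner_eq0.
  have Cl : padic_abs p C ^+ l != 0 by rewrite -padic_absX padic_abs_eq0.
  rewrite padic_absM padic_absV padic_abs1 !padic_absX => /(divr1_eq).
  move=> /esym/(expr_eq_lt1 C_ge0 C_lt1 Cl) <-.
  by rewrite divff // inE eqxx.
Qed.
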